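(* Let $V$ and $W$ be nontrivial real Hilbert spaces and let $G$ be a subgroup of $O(V)$. Suppose $x\in V$ is fixed by some nonidentity member of $G$, and consider any $G$-invariant map $f\colon V\to W$ that is Fréchet differentiable at $x$ (and, for (b), such that the induced map $f^\downarrow\colon V/\!/G\to W$ is well defined, i.e., $f$ is constant on closures of $G$-orbits, which is automatic if $G$ is finite). Then the following hold. (a) There exists a unit vector $v\in V$ orthogonal to $x$ such that $Df(x)v=0$. (b) If $G$ is finite or $x=0$, then $f^\downarrow\colon V/\!/G\to W$ is not lower Lipschitz. (c) If $G$ is finite and $x\in S(V)$, then the restriction $f^\downarrow|_{S(V)/G}$ is not lower Lipschitz.
   Context: $O(V)$ is the group of linear isometric bijections of $V$, and $S(V)$ is the unit sphere of $V$. $Df(x)\colon V\to W$ denotes the Fréchet derivative of $f$ at $x$ (a bounded linear map). The metric quotient is $V/\!/G=\{[x]:x\in V\}$, where $[x]$ is the closure of $G\cdot x$, with metric $d([x],[y])=\inf\{\|p-q\|:p\in G\cdot x,\ q\in G\cdot y\}$. When $G$ is finite, $[x]=G\cdot x$, and one writes $V/G$ for $V/\!/G$; $S(V)/G\subseteq V/G$ is the set of orbits of unit vectors with the same metric. The induced map is $f^\downarrow([x])=f(p)$ for $p\in[x]$. A map $h\colon X\to Y$ between metric spaces is lower Lipschitz if there is $\alpha>0$ such that $d_Y(h(x),h(x'))\geq\alpha\, d_X(x,x')$ for all $x,x'\in X$. *)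

(* Defs.v *)
From HB Require Import structures.
From mathcomp Require Import all_boot all_order all_algebra sesquilinear.
From mathcomp Require Import all_classical all_reals all_analysis.

Set Implicit Arguments.
Unset Strict Implicit.
Unset Printing Implicit Defensive.

Import Order.TTheory GRing.Theory Num.Theory.
Import numFieldNormedType.Exports.

Local Open Scope classical_set_scope.
Local Open Scope ring_scope.

HB.mixin Record CompleteNormedModule_isHilbert (R : realType) V
    & CompleteNormedModule R V := {
  inner : {dot V for (@idfun R)} ;
  inner_norm : forall v : V, inner v v = `|v| ^+ 2
}.

#[short(type="hilbertType")]
HB.structure Definition Hilbert (R : realType) :=
  {V of CompleteNormedModule R V & CompleteNormedModule_isHilbert R V}.

Lemma innerC (R : realType) (V : hilbertType R) (u v : V) :
  inner u v = inner v u.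
Proof. by rewrite hermitian_subproof expr0 mul1r. Qed.

Section OrthogonalGroup.
Context {R : realType} {V : hilbertType R}.

(* For a linear map, preserving the norm is the same as being isometric. *)
Definition orthogonal_map : pred (V -> V) := fun g =>
  `[< [/\ linear g, forall v, `|g v| = `|v| & bijective g] >].

Record orthogonal_group := Orthogonal {
  orthogonal_fun :> V -> V ;
  orthogonal_funP : orthogonal_map orthogonal_fun }.

HB.instance Definition _ := [isSub for orthogonal_fun].
HB.instance Definition _ := [Choice of orthogonal_group by <:].

Lemma orth_eqP (g h : orthogonal_group) : g =1 h -> g = h.
Proof. by move=> gh; apply/val_inj/funext. Qed.

Lemma orth_linear (g : orthogonal_group) : linear g.
Proof. by case: g => g /= /asboolP[]. Qed.

Lemma orth_norm (g : orthogonal_group) v : `|g v| = `|v|.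
Proof. by case: g => g /= /asboolP[]. Qed.

Lemma orth_bij (g : orthogonal_group) : bijective g.
Proof. by case: g => g /= /asboolP[]. Qed.

Lemma orth_sub (g : orthogonal_group) u v : g (u - v) = g u - g v.
Proof. by rewrite addrC -scaleN1r orth_linear scaleN1r addrC. Qed.

Lemma orth_isometry (g : orthogonal_group) u v : `|g u - g v| = `|u - v|.
Proof. by rewrite -orth_sub orth_norm. Qed.

Lemma orthogonal_map_id : orthogonal_map idfun.
Proof. by apply/asboolP; split=> //; exists idfun. Qed.

Lemma orthogonal_map_comp (g h : orthogonal_group) : orthogonal_map (g \o h).
Proof.
apply/asboolP; split=> [a u v|v|] /=.
- by rewrite !orth_linear.
- by rewrite !orth_norm.
- by apply: bij_comp; exact: orth_bij.
Qed.

Lemma orthogonal_inv_ex (g : orthogonal_group) :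
  exists h : orthogonal_group, cancel g h /\ cancel h g.
Proof.
have [h gK hK] := orth_bij g.
have hP : orthogonal_map h.
  apply/asboolP; split=> [a u v|v|]; last by exists g.
  - by apply: (bij_inj (orth_bij g)); rewrite orth_linear !hK.
  - by rewrite -[LHS](orth_norm g) hK.
by exists (Orthogonal hP).
Qed.

Definition orth_one : orthogonal_group := Orthogonal orthogonal_map_id.
Definition orth_mul (g h : orthogonal_group) : orthogonal_group :=
  Orthogonal (orthogonal_map_comp g h).
Definition orth_inv (g : orthogonal_group) : orthogonal_group :=
  projT1 (cid (orthogonal_inv_ex g)).

Lemma orth_invP (g : orthogonal_group) : cancel g (orth_inv g) /\ cancel (orth_inv g) g.
Proof. by rewrite /orth_inv; case: cid. Qed.

Fact orth_mulA : associative orth_mul.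
Proof. by move=> g h k; exact: orth_eqP. Qed.
Fact orth_mul1g : left_id orth_one orth_mul.
Proof. by move=> g; exact: orth_eqP. Qed.
Fact orth_mulg1 : right_id orth_one orth_mul.
Proof. by move=> g; exact: orth_eqP. Qed.
Fact orth_mulVg : left_inverse orth_one orth_inv orth_mul.
Proof. by move=> g; apply: orth_eqP => v /=; rewrite (orth_invP g).1. Qed.
Fact orth_mulgV : right_inverse orth_one orth_inv orth_mul.
Proof. by move=> g; apply: orth_eqP => v /=; rewrite (orth_invP g).2. Qed.

HB.instance Definition _ := isGroup.Build orthogonal_group
  orth_mulA orth_mul1g orth_mulg1 orth_mulVg orth_mulgV.

Lemma orth1E v : (1%g : orthogonal_group) v = v. Proof. by []. Qed.
Lemma orthME (g h : orthogonal_group) v : (g * h)%g v = g (h v). Proof. by []. Qed.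
Lemma orthVK (g : orthogonal_group) : cancel g (g^-1)%g.
Proof. exact: (orth_invP g).1. Qed.
Lemma orthKV (g : orthogonal_group) : cancel (g^-1)%g g.
Proof. exact: (orth_invP g).2. Qed.

End OrthogonalGroup.
Arguments orthogonal_group {R} V.

Section MetricQuotient.
Context {R : realType} {V : hilbertType R}
  (G : groupClosed (orthogonal_group V)).

Definition group_orbit (x : V) : set V := [set g x | g in [set` G]].

Definition orbit_closure (x : V) : set V := closure (group_orbit x).

Definition orbit_dist (x y : V) : R :=
  inf [set `|p - q| | p in group_orbit x & q in group_orbit y].

Record metric_quotient := MetricQuotient {
  quotient_set : set V ;
  quotient_setP : `[< exists x, quotient_set = orbit_closure x >] }.

HB.instance Definition _ := [isSub for quotient_set].
HB.instance Definition _ := [Choice of metric_quotient by <:].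

Fact quotient_class_subproof x :
  `[< exists y, orbit_closure x = orbit_closure y >].
Proof. by apply/asboolP; exists x. Qed.

Definition quotient_class (x : V) : metric_quotient :=
  MetricQuotient (quotient_class_subproof x).

Definition quotient_repr (A : metric_quotient) : V :=
  projT1 (cid (asboolW (quotient_setP A))).

Lemma quotient_reprK : cancel quotient_repr quotient_class.
Proof.
by move=> A; apply: val_inj; rewrite /quotient_repr; case: cid => x /= ->.
Qed.

(* Independent of the chosen representatives, see quotient_dist_class. *)
Definition quotient_dist (A B : metric_quotient) : R :=
  orbit_dist (quotient_repr A) (quotient_repr B).

Lemma group_orbit_refl x : group_orbit x x.
Proof. by exists 1%g => //=; rewrite gpred1. Qed.

Lemma group_orbit_act x (g : orthogonal_group V) :
  g \in G -> group_orbit x (g x).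
Proof. by move=> gG; exists g. Qed.

Lemma group_orbit_trans x y z :
  group_orbit x y -> group_orbit y z -> group_orbit x z.
Proof.
move=> [g /= gG <-] [h /= hG <-]; exists (h * g)%g => //=.
by rewrite gpredM.
Qed.

Lemma orbit_dist_has_inf x y :
  has_inf [set `|p - q| | p in group_orbit x & q in group_orbit y].
Proof.
split; last by exists 0 => _ [p _ [q _ <-]].
by exists `|x - y|, x; [exact: group_orbit_refl|
  exists y => //; exact: group_orbit_refl].
Qed.

Lemma orbit_dist_le x y p q :
  group_orbit x p -> group_orbit y q -> orbit_dist x y <= `|p - q|.
Proof.
move=> xp yq; apply: ge_inf; first exact: (orbit_dist_has_inf x y).2.
by exists p => //; exists q.
Qed.

Lemma le_orbit_dist x y c :
  (forall p q, group_orbit x p -> group_orbit y q -> c <= `|p - q|) ->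
  c <= orbit_dist x y.
Proof.
move=> H; apply: lb_le_inf; first exact: (orbit_dist_has_inf x y).1.
by move=> _ [p xp [q yq <-]]; exact: H.
Qed.

Lemma orbit_dist_lt x y c : orbit_dist x y < c ->
  exists2 z, group_orbit y z & `|x - z| < c.
Proof.
move=> /(inf_lt (orbit_dist_has_inf x y).1)[_ [_ [g /= gG <-] [q yq <-]]] lec.
exists ((g^-1)%g q).
  by apply: group_orbit_trans yq _; apply: group_orbit_act; rewrite gpredV.
by rewrite -(orth_isometry g) orthKV.
Qed.

Lemma orbit_dist_ge0 x y : 0 <= orbit_dist x y.
Proof. by apply: le_orbit_dist. Qed.

Lemma orbit_distxx x : orbit_dist x x = 0.
Proof.
apply/eqP; rewrite eq_le orbit_dist_ge0 andbT.
by rewrite -[leRHS](normr0 V) -(subrr x); apply: orbit_dist_le;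
  exact: group_orbit_refl.
Qed.

Lemma orbit_distC x y : orbit_dist x y = orbit_dist y x.
Proof.
by apply/eqP; rewrite eq_le; apply/andP; split; apply: le_orbit_dist => p q ? ?;
  rewrite distrC; exact: orbit_dist_le.
Qed.

Lemma orbit_dist_triangle y x z :
  orbit_dist x z <= orbit_dist x y + orbit_dist y z.
Proof.
apply/ler_addgt0Pr => e e0; have e20 : 0 < e / 2 by rewrite divr_gt0.
have [q yq xq] : exists2 q, group_orbit y q & `|x - q| < orbit_dist x y + e / 2.
  by apply: orbit_dist_lt; rewrite ltrDl.
have [r zr yr] : exists2 r, group_orbit z r & `|y - r| < orbit_dist y z + e / 2.
  by apply: orbit_dist_lt; rewrite ltrDl.
case: yq xq => g /= gG <- xgy.
have zgr : group_orbit z (g r).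
  by apply: group_orbit_trans zr _; exact: group_orbit_act.
apply: le_trans (orbit_dist_le (group_orbit_refl x) zgr) _.
apply: le_trans (ler_distD (g y) _ _) _; rewrite orth_isometry.
by rewrite [e in leRHS]splitr addrACA ltW// ltrD.
Qed.

Lemma orbit_closureP x p : orbit_closure x p <->
  forall e, 0 < e -> exists2 q, group_orbit x q & `|p - q| < e.
Proof.
split=> [xp e e0|H].
  have [q [xq pq]] := xp _ (nbhsx_ballx p e e0).
  by exists q => //; rewrite -ball_normE in pq.
move=> B /nbhs_ballP[e /= e0 eB]; have [q xq pq] := H e e0.
by exists q; split=> //; apply: eB; rewrite -ball_normE.
Qed.

Lemma orbit_dist_closure x p : orbit_closure x p -> orbit_dist x p = 0.
Proof.
move=> /orbit_closureP xp; apply/eqP; rewrite eq_le orbit_dist_ge0 andbT.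
apply/ler_addgt0Pr => e e0; rewrite add0r; have [q xq /ltW pq] := xp e e0.
apply: le_trans pq; rewrite distrC; apply: orbit_dist_le xq _.
exact: group_orbit_refl.
Qed.

Lemma orbit_closure_refl x : orbit_closure x x.
Proof. by apply: subset_closure; exact: group_orbit_refl. Qed.

Lemma orbit_dist_eq0 x y :
  orbit_dist x y = 0 <-> orbit_closure x = orbit_closure y.
Proof.
split=> [xy0|xy]; last first.
  apply: orbit_dist_closure; rewrite xy; exact: orbit_closure_refl.
have H u v : orbit_dist u v = 0 -> orbit_closure u `<=` orbit_closure v.
  move=> uv0 p /orbit_dist_closure up0; apply/orbit_closureP => e e0.
  apply: orbit_dist_lt; apply: le_lt_trans (orbit_dist_triangle u _ _) _.
  by rewrite orbit_distC up0 uv0 addr0.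
by apply/seteqP; split; apply: H => //; rewrite orbit_distC.
Qed.

Lemma orbit_dist_congr x x' y y' :
  orbit_closure x = orbit_closure x' -> orbit_closure y = orbit_closure y' ->
  orbit_dist x y = orbit_dist x' y'.
Proof.
have H u u' v v' : orbit_closure u = orbit_closure u' ->
    orbit_closure v = orbit_closure v' -> orbit_dist u v <= orbit_dist u' v'.
  move=> /orbit_dist_eq0 uu' /orbit_dist_eq0 vv'.
  apply: le_trans (orbit_dist_triangle u' _ _) _; rewrite uu' add0r.
  by apply: le_trans (orbit_dist_triangle v' _ _) _; rewrite orbit_distC
    [orbit_dist v' v]orbit_distC vv' addr0 orbit_distC.
by move=> xx' yy'; apply/eqP; rewrite eq_le !H.
Qed.

Lemma quotient_class_repr x :
  orbit_closure (quotient_repr (quotient_class x)) = orbit_closure x.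
Proof. by have /(congr1 quotient_set) := quotient_reprK (quotient_class x). Qed.

Lemma quotient_dist_class x y :
  quotient_dist (quotient_class x) (quotient_class y) = orbit_dist x y.
Proof. by apply: orbit_dist_congr; exact: quotient_class_repr. Qed.

Fact quotient_distxx A : quotient_dist A A = 0.
Proof. exact: orbit_distxx. Qed.
Fact quotient_dist_positivity A B : quotient_dist A B = 0 -> A = B.
Proof.
move=> /orbit_dist_eq0 AB; rewrite -[A]quotient_reprK -[B]quotient_reprK.
exact: val_inj.
Qed.
Fact quotient_distC A B : quotient_dist A B = quotient_dist B A.
Proof. exact: orbit_distC. Qed.
Fact quotient_dist_triangle B A C :
  quotient_dist A C <= quotient_dist A B + quotient_dist B C.
Proof. exact: orbit_dist_triangle. Qed.

HB.instance Definition _ := isMetric.Build R metric_quotient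
  quotient_distxx quotient_dist_positivity quotient_distC
  quotient_dist_triangle.

Lemma mdist_class x y :
  mdist (quotient_class x) (quotient_class y) = orbit_dist x y.
Proof. exact: quotient_dist_class. Qed.

Definition sphere_quotient : set metric_quotient :=
  quotient_class @` [set v | `|v| = 1].

Definition group_invariant (W : Type) (f : V -> W) : Prop :=
  forall g v, g \in G -> f (g v) = f v.

Definition constant_on_closures (W : Type) (f : V -> W) : Prop :=
  forall x p, orbit_closure x p -> f p = f x.

Lemma finite_orbit_closure x :
  finite_set [set` G] -> orbit_closure x = group_orbit x.
Proof.
move=> Gfin; have fin_closed := accessible_finite_set_closed.1
  (hausdorff_accessible (@norm_hausdorff _ V)).
rewrite /orbit_closure -(closure_id _).1//; apply: fin_closed; exact: finite_image.
Qed.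

Lemma finite_constant_on_closures (W : Type) (f : V -> W) :
  finite_set [set` G] -> group_invariant f -> constant_on_closures f.
Proof.
move=> Gfin finv x p; rewrite finite_orbit_closure// => -[g gG <-].
exact: finv.
Qed.

(* Meaningful when f is constant on closures of orbits, in which case it does
   not depend on the chosen representative, see induced_mapE. *)
Definition induced_map (W : Type) (f : V -> W) (A : metric_quotient) : W :=
  f (quotient_repr A).

Lemma induced_mapE (W : Type) (f : V -> W) (A : metric_quotient) (p : V) :
  constant_on_closures f -> quotient_set A p -> induced_map f A = f p.
Proof.
move=> fc Ap; rewrite /induced_map (fc (quotient_repr A))//.
by rewrite -[orbit_closure _]/(quotient_set (quotient_class _)) quotient_reprK.
Qed.

End MetricQuotient.
Arguments quotient_class {R V} G x.
Arguments sphere_quotient {R V} G.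
Arguments group_invariant {R V} G {W} f.
Arguments constant_on_closures {R V} G {W} f.
Arguments induced_map {R V} G {W} f A.

Definition lower_lipschitz_on (R : realType) (X : metricType R)
    (W : normedModType R) (A : set X) (h : X -> W) : Prop :=
  exists2 alpha : R, 0 < alpha &
    forall x x', A x -> A x' -> alpha * mdist x x' <= `|h x - h x'|.

Definition lower_lipschitz (R : realType) (X : metricType R)
    (W : normedModType R) (h : X -> W) : Prop :=
  lower_lipschitz_on setT h.

(* Main.v *)
(* If g fixes x and f is g-invariant, then Df(x) g = Df(x), so Df(x) kills every
   g u - u; since g is isometric and fixes x, these vectors are orthogonal to x,
   and one of them is nonzero.  When x is an isolated point of its orbit, the
   quotient distance from [x + h] to [x] is |h| for small h, whereas f moves only
   by o(|h|) if h is, to first order, in the kernel of Df(x).  On the sphere, h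
   follows the great circle through x in the killed direction. *)

Require Import Defs.
From mathcomp Require Import all_boot all_order all_algebra sesquilinear.
From mathcomp Require Import all_classical all_reals all_analysis.
From mathcomp Require Import ring lra.

Set Implicit Arguments.
Unset Strict Implicit.
Unset Printing Implicit Defensive.

Import Order.TTheory GRing.Theory Num.Theory.
Import numFieldNormedType.Exports.

Local Open Scope classical_set_scope.
Local Open Scope ring_scope.

Lemma innerDl (R : realType) (V : hilbertType R) (u v w : V) :
  inner (u + v) w = inner u w + inner v w.
Proof. exact: linearDl. Qed.

Lemma innerZl (R : realType) (V : hilbertType R) (a : R) (u v : V) :
  inner (a *: u) v = a * inner u v.
Proof. exact: linearZl_LR. Qed.

Lemma normD_sqr (R : realType) (V : hilbertType R) (u v : V) :
  `|u + v| ^+ 2 = `|u| ^+ 2 + `|v| ^+ 2 + inner u v *+ 2.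
Proof.
rewrite -!inner_norm innerDl (innerC u) (innerC v) !innerDl (innerC v u).
by rewrite mulr2n; ring.
Qed.

(** Polarization: orthogonal maps are specified through norms only, so the inner product is
    recovered by expanding the squared norm of [g (u + v)]. *)
Lemma inner_orth (R : realType) (V : hilbertType R) (g : orthogonal_group V)
    (u v : V) :
  inner (g u) (g v) = inner u v.
Proof.
have gD : g (u + v) = g u + g v by rewrite -[u]scale1r orth_linear !scale1r.
have := normD_sqr (g u) (g v).
rewrite -gD !orth_norm normD_sqr => /addrI.
by rewrite !mulr2n; lra.
Qed.

(** As [g] fixes [x], [h *: g u + x] is [g (h *: u + x)]; the difference quotients of [f] along
    [g u] and [u] thus agree before any limit is taken. *)
Lemma diff_invariant (R : realType) (V W : hilbertType R)
    (G : groupClosed (orthogonal_group V)) (f : V -> W) (x : V)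
    (g : orthogonal_group V) (u : V) :
  group_invariant G f -> differentiable f x -> g \in G -> g x = x ->
  'd f x (g u) = 'd f x u.
Proof.
move=> finv fx gG gx; rewrite -!deriveE// /derive.
suff -> : (fun h => h^-1 *: ((f \o shift x) (h *: g u) - f x)) =
  (fun h => h^-1 *: ((f \o shift x) (h *: u) - f x)) by [].
apply/funext => h /=.
by rewrite -(finv g (h *: u + x))// orth_linear gx.
Qed.

(** The orbit without [x] is finite, hence closed, so its complement contains a ball around [x]. *)
Lemma finite_orbit_isolated (R : realType) (V : hilbertType R)
    (G : groupClosed (orthogonal_group V)) (x : V) :
  finite_set [set` G] ->
  exists2 d : R, 0 < d &
    forall q, group_orbit G x q -> `|q - x| < d -> q = x.
Proof.
move=> Gfin.
have cl : closed (group_orbit G x `\ x).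
  apply: (accessible_finite_set_closed.1
    (hausdorff_accessible (@norm_hausdorff _ V))).
  by apply: finite_setD; exact: finite_image.
have nx : nbhs x (~` (group_orbit G x `\ x)).
  by apply: open_nbhs_nbhs; split; [exact: closed_openC | case=> _; exact].
case/nbhs_ballP: nx => d /= d0 dP; exists d => // q xq qx.
apply: contrapT => neq; apply: (dP q) => //.
by rewrite -ball_normE /= distrC.
Qed.

(** An orbit point [z] closer than [|h|] to [x + h] would lie within [2|h| < d] of [x], hence be [x]
    itself, which is at distance exactly [|h|]. *)
Lemma le_orbit_dist_isolated (R : realType) (V : hilbertType R)
    (G : groupClosed (orthogonal_group V)) (x h : V) (d : R) :
  (forall q, group_orbit G x q -> `|q - x| < d -> q = x) ->
  `|h| < d / 2 -> `|h| <= orbit_dist G (x + h) x.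
Proof.
move=> iso hd; rewrite leNgt; apply/negP => /orbit_dist_lt[z xz zh].
have zx : z = x.
  apply: iso => //; apply: le_lt_trans (ler_distD (x + h) _ _) _.
  by rewrite (addrC x h) addrK [d]splitr ltrD// distrC addrC (lt_trans zh).
by move: zh; rewrite zx (addrC x) addrK ltxx.
Qed.

(** The remainder and the derivative each contribute at most [alpha / 4 * |h|], against a lower
    bound of [alpha * |h|]. The kernel condition is only approximate because on the sphere [h] also
    has a second-order component along [x]. *)
Lemma flat_direction_contra (R : realType) (V W : hilbertType R)
    (G : groupClosed (orthogonal_group V)) (f : V -> W) (x : V) (d alpha : R) :
  differentiable f x -> 0 < d -> 0 < alpha ->
  (forall q, group_orbit G x q -> `|q - x| < d -> q = x) ->
  (forall e : R, 0 < e -> exists h : V,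
    [/\ h != 0, `|h| < e, `|'d f x h| <= e * `|h| &
        alpha * orbit_dist G (x + h) x <= `|f (x + h) - f x|]) -> False.
Proof.
move=> fx d0 a0 iso H.
have a40 : 0 < alpha / 4 by rewrite divr_gt0.
have /eqaddoP/(_ _ a40)/nbhs_ballP[r /= r0 rP] := diff_locally fx.
(* The three bounds serve the remainder estimate, the isolation of [x] and the size of ['d f x h],
   in this order. *)
pose e := Num.min (Num.min r (d / 2)) (alpha / 4).
have e0 : 0 < e by rewrite !lt_min r0 a40 divr_gt0.
have [h [h0]] := H e e0.
rewrite {1}/e !lt_min => /andP[/andP[hr hd] _] dh ah.
have := rP h; rewrite -ball_normE /= sub0r normrN => /(_ hr).
rewrite /= -[(f \o shift x - _) h]/(f (h + x) - (f x + 'd f x h)).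
rewrite opprD addrA (addrC h) => oh.
have hp : 0 < `|h| by rewrite normr_gt0.
have /(ler_wpM2l (ltW a0)) od := le_orbit_dist_isolated iso hd.
have := ler_distD ('d f x h) (f (x + h) - f x) 0; rewrite !subr0 => tri.
have dh4 : `|'d f x h| <= alpha / 4 * `|h|.
  by apply: le_trans dh _; rewrite ler_pM2r// ge_min lexx orbT.
have : 0 < alpha * `|h| by rewrite mulr_gt0.
lra.
Qed.

Theorem theorem21 (R : realType) (V W : hilbertType R)
    (V_nontrivial : exists v : V, v != 0)
    (W_nontrivial : exists w : W, w != 0)
    (G : groupClosed (orthogonal_group V)) (x : V)
    (x_fixed : exists g : orthogonal_group V, [/\ g \in G, g != 1%g & g x = x])
    (f : V -> W)
    (f_invariant : group_invariant G f)
    (f_differentiable : differentiable f x) :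
  [/\ exists v : V, [/\ `|v| = 1, inner v x = 0 & 'd f x v = 0],
      constant_on_closures G f -> finite_set [set` G] \/ x = 0 ->
        ~ lower_lipschitz (induced_map G f)
    & finite_set [set` G] -> `|x| = 1 ->
        ~ lower_lipschitz_on (sphere_quotient G) (induced_map G f)].
Proof.
have [v [v1 vx dv]] : exists v : V, [/\ `|v| = 1, inner v x = 0 & 'd f x v = 0].
  have [g [gG g1 gx]] := x_fixed.
  have [u gu] : exists u, g u != u.
    apply: contrapT => /forallNP H; case/negP: g1; apply/eqP/orth_eqP => u.
    by apply: contrapT => /eqP gu; exact: (H u).
  have w0 : `|g u - u| != 0 by rewrite normr_eq0 subr_eq0.
  exists (`|g u - u|^-1 *: (g u - u)); split.
  - by rewrite normrZ normfV normr_id mulVf.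
  (* Replacing [x] by [g x] in the first product turns it into [inner u x], which cancels the
     second. *)
  - by rewrite innerZl innerDl -scaleN1r innerZl -{1}gx inner_orth mulN1r subrr mulr0.
  - rewrite linearZ linearB/=.
    by rewrite (diff_invariant u f_invariant f_differentiable gG gx) subrr scaler0.
split; first by exists v.
- move=> fc fin0 [alpha a0 lip].
  have [d d0 iso] : exists2 d : R, 0 < d &
      forall q, group_orbit G x q -> `|q - x| < d -> q = x.
    case: fin0 => [|->]; first exact: finite_orbit_isolated.
    (* The orbit of 0 is a single point, so any radius works. *)
    exists 1 => // q [g _ <-] _.
    by apply/eqP; rewrite -normr_eq0 orth_norm normr0.
  have indE y : induced_map G f (quotient_class G y) = f y.
    by apply: induced_mapE => //; exact: orbit_closure_refl.
  apply: (flat_direction_contra f_differentiable d0 a0 iso) => e e0.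
  have ne : `|(e / 2) *: v| = e / 2.
    by rewrite normrZ v1 mulr1 gtr0_norm// divr_gt0.
  exists ((e / 2) *: v); split.
  + by rewrite -normr_gt0 ne divr_gt0.
  + by rewrite ne; lra.
  + by rewrite linearZ/= dv scaler0 normr0 mulr_ge0// ltW.
  + have := lip (quotient_class G (x + (e / 2) *: v)) (quotient_class G x) I I.
    by rewrite mdist_class !indE.
- move=> Gfin x1 [alpha a0 lip].
  have fc := finite_constant_on_closures Gfin f_invariant.
  have [d d0 iso] := finite_orbit_isolated x Gfin.
  have indE y : induced_map G f (quotient_class G y) = f y.
    by apply: induced_mapE => //; exact: orbit_closure_refl.
  apply: (flat_direction_contra f_differentiable d0 a0 iso) => e e0.
  (* x + h = ((1 - t^2) x + 2 t v) / (1 + t^2) is a rational parametrization of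
     the great circle through x in the direction v. *)
  have combE (a b : R) : `|a *: x + b *: v| ^+ 2 = a ^+ 2 + b ^+ 2.
    rewrite normD_sqr !normrZ x1 v1 !mulr1 !real_normK ?num_real// innerZl.
    by rewrite innerC innerZl vx !mulr0 mul0rn addr0.
  pose K := `|'d f x x|.
  have K0 : 0 <= K by exact: normr_ge0.
  (* With [t * (3 + K) <= e], both [|h| <= 2 * t < e] and [t * K <= e] hold; the latter controls the
     derivative. *)
  pose t := Num.min 1 (e / (3 + K)).
  have t0 : 0 < t by rewrite lt_min ltr01 divr_gt0// ltr_wpDr.
  have te : t * (3 + K) <= e.
    by rewrite -ler_pdivlMr ?ltr_wpDr// ge_min lexx orbT.
  have s0 : 0 < 1 + t ^+ 2 by rewrite ltr_wpDr// sqr_ge0.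
  have sn : 1 + t ^+ 2 != 0 by rewrite gt_eqF.
  pose h := (- (2 * t ^+ 2 / (1 + t ^+ 2))) *: x + (2 * t / (1 + t ^+ 2)) *: v.
  have hE : `|h| ^+ 2 = 4 * t ^+ 2 / (1 + t ^+ 2).
    by rewrite combE; field.
  have xh1 : `|x + h| = 1.
    apply/eqP; rewrite -(@eqrXn2 _ 2)// expr1n -[x in x + _]scale1r addrA.
    by rewrite -scalerDl combE; apply/eqP; field.
  have tK0 : 0 <= t * K by rewrite mulr_ge0// ltW.
  have h2t : `|h| <= 2 * t.
    rewrite -(@ler_pXn2r _ 2)// ?nnegrE ?mulr_ge0 ?(ltW t0)//.
    rewrite hE ler_pdivrMr//; nra.
  exists h; split.
  + rewrite -normr_eq0 -sqrf_eq0 hE gt_eqF// divr_gt0// mulr_gt0//.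
    exact: exprn_gt0.
  + lra.
  + have -> : 'd f x h = (- (2 * t ^+ 2 / (1 + t ^+ 2))) *: 'd f x x.
      by rewrite linearD !linearZ/= dv scaler0 addr0.
    rewrite normrZ normrN ger0_norm; last first.
      by apply: divr_ge0 (ltW s0); apply: mulr_ge0 => //; exact: sqr_ge0.
    rewrite -/K.
    (* Only the [x]-component of [h] survives under ['d f x]. Its size is [t * |h|] divided by the
       square root of [1 + t ^+ 2]; comparing squares avoids the root. *)
    have th : 2 * t ^+ 2 / (1 + t ^+ 2) <= t * `|h|.
      rewrite -(@ler_pXn2r _ 2)// ?nnegrE; last first.
      * by rewrite mulr_ge0// ltW.
      * by rewrite divr_ge0// ?(ltW s0)// mulr_ge0// sqr_ge0.
      rewrite [leRHS]exprMn hE -subr_ge0.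
      have -> : t ^+ 2 * (4 * t ^+ 2 / (1 + t ^+ 2)) -
          (2 * t ^+ 2 / (1 + t ^+ 2)) ^+ 2 = 4 * t ^+ 6 / (1 + t ^+ 2) ^+ 2.
        by field.
      apply: divr_ge0 (sqr_ge0 _); apply: mulr_ge0 => //.
      exact: exprn_ge0 (ltW t0).
    apply: le_trans (ler_wpM2r K0 th) _.
    rewrite mulrAC ler_wpM2r//; lra.
  + have := lip (quotient_class G (x + h)) (quotient_class G x).
    rewrite mdist_class !indE; apply; first by exists (x + h).
    by exists x.
Qed.
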